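(* Let $m\ge 2$, $1\le\ell\le m$, let $F=(f_1,\dots,f_\ell)$ be a bent vectorial function from $\mathrm{GF}(2^{2m})$ to $\mathrm{GF}(2)^\ell$, and let $\mathbf{D}$ be the design with block set $\mathcal{B}$ whose points are the $2^{2m}$ coordinate positions and whose blocks are the supports of the minimum-weight codewords of $\mathcal{C}(f_1,\dots,f_\ell)$. For a block $B\in\mathcal{B}$, let $\mathcal{B}^{de}$ be the collection of sets $B\cap B'$ with $B'\in\mathcal{B}$ and $|B\cap B'|=2^{2m-2}-2^{m-1}$. Then for each $B\in\mathcal{B}$, the incidence structure $(B,\mathcal{B}^{de})$ is a quasi-symmetric $2$-$(2^{2m-1}-2^{m-1},\,2^{2m-2}-2^{m-1},\,2^{2m-2}-2^{m-1}-1)$ design with intersection numbers $2^{2m-3}-2^{m-2}$ and $2^{2m-3}-2^{m-1}$.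
   Context: Write $\mathrm{GF}(2^{2m})=\{u_1,\dots,u_q\}$, $q=2^{2m}$, and let $\mathrm{tr}_{2m/1}$ be the absolute trace to $\mathrm{GF}(2)$. A Boolean function $f:\mathrm{GF}(2^{2m})\to\mathrm{GF}(2)$ is bent if $\left|\sum_{x}(-1)^{f(x)+\mathrm{tr}_{2m/1}(wx)}\right|=2^m$ for all $w$. $F=(f_1,\dots,f_\ell)$ is a bent vectorial function if $\sum_j a_jf_j$ is bent for every nonzero $(a_1,\dots,a_\ell)\in\mathrm{GF}(2)^\ell$. The truth table of $f$ is $(f(u_1),\dots,f(u_q))$. $\mathrm{RM}_2(1,2m)=\{(\mathrm{tr}_{2m/1}(bu_i)+c)_{i=1}^q:b\in\mathrm{GF}(2^{2m}),c\in\mathrm{GF}(2)\}$, and $\mathcal{C}(f_1,\dots,f_\ell)$ is the binary linear code spanned by $\mathrm{RM}_2(1,2m)$ and the truth tables of $f_1,\dots,f_\ell$; its minimum weight is $2^{2m-1}-2^{m-1}$. A $2$-design is quasi-symmetric with intersection numbers $x<y$ if any two distinct blocks meet in either $x$ or $y$ points. *)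

(* Defs.v *)
From HB Require Import structures.
From mathcomp Require Import all_boot all_order all_algebra all_field.

Set Implicit Arguments.
Unset Strict Implicit.
Unset Printing Implicit Defensive.

Import GRing.Theory Num.Theory.

Section Trace.
Local Open Scope ring_scope.
Variables (K : finFieldType) (m : nat).

(* Tr_{2m/1}(x), as an element of K = GF(2^{2m}). *)
Definition trace_in (x : K) : K := \sum_(i < 2 * m) x ^+ (2 ^ i).

(* trace_in takes only the values 0 and 1; tr is the same value read in 'F_2
   (see trE). *)
Definition tr (x : K) : 'F_2 := (trace_in x != 0)%:R.

Lemma trE (hK : #|K| = (2 ^ (2 * m))%N) (x : K) :
  (nat_of_ord (tr x))%:R = trace_in x.
Proof.
have m_gt0 : (0 < 2 * m)%N.
  by case: (posnP (2 * m)) hK => // -> h; have := finNzRing_gt1 K; rewrite h.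
have ch2 : 2%N \in [pchar K] by apply: (card_finPcharP hK).
have idem : trace_in x ^+ 2 = trace_in x.
  rewrite /trace_in -(pFrobenius_autE ch2) rmorph_sum /=.
  under eq_bigr => i _ do rewrite pFrobenius_autE -exprM -expnSr.
  case: (2 * m)%N m_gt0 hK => // n _ hK.
  rewrite big_ord_recr /= -hK expf_card big_ord_recl /= expr1 addrC.
  by congr (_ + _).
have : trace_in x * (trace_in x - 1) == 0 by rewrite mulrBr mulr1 -expr2 idem subrr.
rewrite mulf_eq0 subr_eq0 /tr => /orP[/eqP-> | /eqP->].
  by rewrite eqxx.
by rewrite oner_eq0.
Qed.

Definition bent (f : K -> 'F_2) : Prop :=
  forall w : K,
    `|\sum_(x : K) (-1) ^+ nat_of_ord (f x + tr (w * x)) : int| = 2 ^+ m.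

Definition bent_vectorial (l : nat) (f : 'I_l -> K -> 'F_2) : Prop :=
  forall a : 'rV['F_2]_l, a != 0 -> bent (fun x => \sum_(j < l) a 0 j * f j x).

End Trace.

Section Codes.
Local Open Scope ring_scope.

Definition support (n : nat) (c : 'rV['F_2]_n) : {set 'I_n} :=
  [set i | c 0 i != 0].

Definition weight (n : nat) (c : 'rV['F_2]_n) : nat := #|support c|.

Definition min_weight_codeword (n : nat) (C : {vspace 'rV['F_2]_n})
    (c : 'rV['F_2]_n) : bool :=
  [&& c \in C, c != 0 &
      [forall c' : 'rV['F_2]_n,
         (c' \in C) && (c' != 0) ==> (weight c <= weight c')%N]].

Definition min_weight_blocks (n : nat) (C : {vspace 'rV['F_2]_n}) :
    {set {set 'I_n}} :=
  [set support c | c in [set c | min_weight_codeword C c]].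

Definition truth_table (K : finFieldType) (n : nat) (u : 'I_n -> K)
    (f : K -> 'F_2) : 'rV['F_2]_n := \row_i f (u i).

Definition RM1 (K : finFieldType) (m n : nat) (u : 'I_n -> K) :
    seq 'rV['F_2]_n :=
  [seq \row_i (tr m (b * u i) + c) | b <- enum K, c <- enum 'F_2].

Definition bent_code (K : finFieldType) (m n : nat) (u : 'I_n -> K)
    (l : nat) (f : 'I_l -> K -> 'F_2) : {vspace 'rV['F_2]_n} :=
  (<<RM1 m u ++ [seq truth_table u (f j) | j <- enum 'I_l]>>)%VS.

End Codes.

Section Designs.
Variable T : finType.

Definition design (t v k lam : nat) (X : {set T}) (Bs : {set {set T}}) : Prop :=
  [/\ t <= k <= v, #|X| = v,
      (forall B, B \in Bs -> B \subset X /\ #|B| = k)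
    & (forall S : {set T}, S \subset X -> #|S| = t ->
         #|[set B in Bs | S \subset B]| = lam)].

Definition quasi_symmetric (x y : nat) (Bs : {set {set T}}) : Prop :=
  x < y /\
  (forall B1 B2, B1 \in Bs -> B2 \in Bs -> B1 <> B2 ->
     #|B1 :&: B2| = x \/ #|B1 :&: B2| = y).

Definition derived_blocks (s : nat) (Bs : {set {set T}}) (B : {set T}) :
    {set {set T}} :=
  [set B :&: B' | B' in [set B' in Bs | #|B :&: B'| == s]].

End Designs.

(* Main.v *)
(* For a bent function [g], each [g + tr (b x)] or its complement takes the
   value 1 on exactly 2^(2m-1) - 2^(m-1) points; call it a translate of [g].
   The sum of two translates is affine, so their supports are the blocks of a
   symmetric 2-design; the sum of three is again bent, which leaves two values
   for the triple intersections.  Hence the derived design at any block is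
   quasi-symmetric.  In the code, every word is affine or bent, and two words of
   minimum weight meet in 2^(2m-2) - 2^(m-1) points only if their difference is
   affine; so the blocks that define the derived structure at the support of [g]
   are exactly the other translates of [g]. *)
Require Import Defs.
From mathcomp Require Import all_boot all_order all_algebra all_field.
From mathcomp Require Import zify.

Set Implicit Arguments.
Unset Strict Implicit.
Unset Printing Implicit Defensive.

Import GRing.Theory Num.Theory.
Local Open Scope ring_scope.

(** * Signs and sign sums *)

Variant F2_spec : 'F_2 -> Type :=
  | F2_is0 : F2_spec 0
  | F2_is1 : F2_spec 1.

Lemma F2P (x : 'F_2) : F2_spec x.
Proof.
have [-> | neq0] := eqVneq x 0; first exact: F2_is0.
suff -> : x = 1 by exact: F2_is1.
by case: x neq0 => [[|[|//]] lt_x2] // _; apply: val_inj.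
Qed.

Lemma addrr_F2 (x : 'F_2) : x + x = 0.
Proof. by case: (F2P x); apply: val_inj. Qed.

Lemma oppr_F2 (x : 'F_2) : - x = x.
Proof. by case: (F2P x); apply: val_inj. Qed.

Lemma addr_eq0_F2 (x y : 'F_2) : (x + y == 0) = (x == y).
Proof. by case: (F2P x); case: (F2P y). Qed.

Definition sgn (x : 'F_2) : int := (-1) ^+ nat_of_ord x.

Lemma sgnD : {morph sgn : x y / x + y >-> x * y}.
Proof. by move=> x y; case: (F2P x); case: (F2P y). Qed.

Lemma sgn_inj : injective sgn.
Proof. by move=> x y; case: (F2P x); case: (F2P y). Qed.

Lemma normr_sgn x : `|sgn x| = 1.
Proof. by case: (F2P x). Qed.

Section SignSums.
Variable I : finType.
Implicit Types f g h : I -> 'F_2.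

Definition signsum g : int := \sum_i sgn (g i).
Definition supp g : {set I} := [set i | g i != 0].

Lemma eq_signsum g h : g =1 h -> signsum g = signsum h.
Proof. by move=> gh; apply: eq_bigr => i _; rewrite gh. Qed.

Lemma eq_supp g h : g =1 h -> supp g = supp h.
Proof. by move=> gh; apply/setP => i; rewrite !inE gh. Qed.

Lemma signsum_addc g c : signsum (fun i => g i + c) = signsum g * sgn c.
Proof. by rewrite /signsum mulr_suml; apply: eq_bigr => i _; rewrite sgnD. Qed.

Lemma normr_signsum_addc g c : `|signsum (fun i => g i + c)| = `|signsum g|.
Proof. by rewrite signsum_addc normrM normr_sgn mulr1. Qed.

Lemma signsum_const c : signsum (fun=> c) = #|I|%:Z * sgn c.
Proof. by rewrite /signsum sumr_const -mulr_natl natz. Qed.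

Lemma card_sum_mem (A : {set I}) : #|A|%:Z = \sum_i (i \in A)%:R.
Proof.
rewrite -sum1_card -natz natr_sum big_mkcond /=.
by apply: eq_bigr => i _; case: (i \in A).
Qed.

Lemma card_supp g : 2 * #|supp g|%:Z = #|I|%:Z - signsum g.
Proof.
rewrite card_sum_mem mulr_sumr -[#|I|%:Z]mulr1 -(signsum_const 0) -sumrB.
by apply: eq_bigr => i _; rewrite inE; case: (F2P (g i)).
Qed.

Lemma card_suppI f g :
  4 * #|supp f :&: supp g|%:Z
  = #|I|%:Z - signsum f - signsum g + signsum (f \+ g).
Proof.
rewrite card_sum_mem mulr_sumr -[#|I|%:Z]mulr1 -(signsum_const 0).
rewrite -!sumrB -big_split; apply: eq_bigr => i _; rewrite !inE /=.
by case: (F2P (f i)); case: (F2P (g i)).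
Qed.

Lemma card_suppII f g h :
  8 * #|supp f :&: supp g :&: supp h|%:Z
  = #|I|%:Z - signsum f - signsum g - signsum h + signsum (f \+ g)
    + signsum (f \+ h) + signsum (g \+ h) - signsum (f \+ g \+ h).
Proof.
rewrite card_sum_mem mulr_sumr -[#|I|%:Z]mulr1 -(signsum_const 0).
rewrite -!(sumrB, big_split); apply: eq_bigr => i _; rewrite !inE /=.
by case: (F2P (f i)); case: (F2P (g i)); case: (F2P (h i)).
Qed.

End SignSums.

Lemma signsum_comp (I J : finType) (u : I -> J) (g : J -> 'F_2) :
  bijective u -> signsum (g \o u) = signsum g.
Proof. by move=> u_bij; rewrite [RHS](reindex u) //; apply: onW_bij. Qed.

Lemma signsum_additive (V : finZmodType) (chi : V -> 'F_2) :
  {morph chi : x y / x + y} -> (exists x, chi x != 0) -> signsum chi = 0.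
Proof.
move=> chiD [x0 chi_x0].
suff: signsum chi = - signsum chi by lia.
rewrite {1}/signsum (reindex_inj (addIr x0)) -mulrN1.
rewrite -[-1]/(sgn 1) -signsum_addc; apply: eq_bigr => x _ /=.
by rewrite chiD; case: (F2P (chi x0)) chi_x0.
Qed.

(** * Derived designs *)

Section DerivedDesign.
Variables (T : finType) (Bs : {set {set T}}) (B0 : {set T}) (s : nat).

Lemma eq_derived_blocks (Bs' : {set {set T}}) :
  (forall B, #|B0 :&: B| = s -> (B \in Bs) = (B \in Bs')) ->
  derived_blocks s Bs B0 = derived_blocks s Bs' B0.
Proof.
move=> eqBs; congr [set B0 :&: B | B in pred_of_set _]; apply/setP => B.
rewrite !inE.
by case: eqP => [/eqBs ->|]; rewrite ?andbF.
Qed.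

Hypothesis lt_s_B0 : (s < #|B0|)%N.
Hypothesis meet_B0 : {in Bs :\ B0, forall B, #|B0 :&: B| = s}.

Lemma derived_blocksE :
  derived_blocks s Bs B0 = [set B0 :&: B | B in Bs :\ B0].
Proof.
congr [set B0 :&: B | B in pred_of_set _]; apply/setP => B.
rewrite inE in_setD1 andbC.
have [-> | neqB] := eqVneq B B0; first by rewrite setIid gtn_eqF.
case: (boolP (B \in Bs)) => [BsB | _]; last by rewrite andbF.
by rewrite meet_B0 ?eqxx // in_setD1 neqB.
Qed.

Lemma setI_inj_of_triple_meets :
  {in Bs :\ B0 &, forall B C, B != C -> #|B0 :&: B :&: C| != s} ->
  {in Bs :\ B0 &, injective (setI B0)}.
Proof.
move=> triple B C BsB BsC eq_BC; apply: contraTeq isT => neq_BC.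
by have := triple B C BsB BsC neq_BC; rewrite eq_BC -setIA setIid meet_B0 ?eqxx.
Qed.

Lemma derived_design (t v k lam : nat) (X : {set T}) :
  (t <= s)%N -> B0 \in Bs -> design t v k lam X Bs ->
  {in Bs :\ B0 &, injective (setI B0)} ->
  design t k s (lam - 1) B0 (derived_blocks s Bs B0).
Proof.
move=> le_ts BsB0 [_ _ Bs_k Bs_lam] inj_meet; rewrite derived_blocksE.
have [sB0X card_B0] := Bs_k _ BsB0.
split=> // [|_ /imsetP[B BsB ->]|S sSB0 card_S].
- by rewrite le_ts -card_B0 ltnW.
- by rewrite subsetIl meet_B0.
- set Bs_S := [set B in Bs | S \subset B].
  have BsS_B0 : B0 \in Bs_S by rewrite inE BsB0.
  rewrite -(Bs_lam S) ?(subset_trans sSB0) // -/Bs_S.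
  rewrite (cardsD1 B0 Bs_S) BsS_B0 addKn.
  rewrite -(@card_in_imset _ _ (setI B0)) => [|B C]; last first.
    rewrite !in_setD1 !inE => /and3P[B0B BsB _] /and3P[B0C BsC _].
    by apply: inj_meet; rewrite in_setD1 ?B0B ?B0C.
  apply: eq_card => B; rewrite inE; apply/andP/imsetP.
    case=> /imsetP[C + ->]; rewrite in_setD1 subsetI sSB0 => /andP[C0 BsC] sSC.
    by exists C; rewrite // !inE C0 BsC.
  case=> C; rewrite !inE => /and3P[C0 BsC sSC] ->.
  by rewrite subsetI sSB0 imset_f // in_setD1 C0.
Qed.

Lemma derived_quasi_symmetric (x y : nat) :
  (x < y)%N ->
  {in Bs :\ B0 &, forall B C, B != C ->
     #|B0 :&: B :&: C| = x \/ #|B0 :&: B :&: C| = y} ->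
  quasi_symmetric x y (derived_blocks s Bs B0).
Proof.
move=> lt_xy triple; rewrite derived_blocksE; split=> //.
move=> _ _ /imsetP[B BsB ->] /imsetP[C BsC ->] neq_BC.
rewrite setIACA setIid setIA; apply: triple => //.
by apply/eqP => eq_BC; apply: neq_BC; rewrite eq_BC.
Qed.

End DerivedDesign.

(** * Bent functions with respect to a perfect pairing *)

(* Abstracts the trace form [(b, i) |-> tr (b * u i)]. *)
Record perfect_pairing (V : finZmodType) (I : finType) (phi : V -> I -> 'F_2) :
  Prop := {
    pairingD : forall b c, phi (b + c) =1 phi b \+ phi c;
    pairing_balanced : forall b, b != 0 -> signsum (phi b) = 0;
    pairing_separates : forall i j, i != j -> exists b, phi b i != phi b j
  }.

Section PerfectPairing.
Variables (V : finZmodType) (I : finType) (phi : V -> I -> 'F_2).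
Hypothesis phi_perfect : perfect_pairing phi.

Lemma pairing0 i : phi 0 i = 0.
Proof. by have := pairingD phi_perfect 0 0 i; rewrite addr0 /= addrr_F2. Qed.

Lemma pairing_addrr (b : V) : (0 < #|I|)%N -> b + b = 0.
Proof.
move=> I_gt0; apply: contraTeq isT => /(pairing_balanced phi_perfect).
rewrite (@eq_signsum _ _ (fun=> 0)) => [|i]; last first.
  by rewrite pairingD //= addrr_F2.
by rewrite signsum_const mulr1; lia.
Qed.

Lemma signsum_pairing_col i j :
  i != j -> signsum (fun b => phi b i + phi b j) = 0.
Proof.
move=> /(pairing_separates phi_perfect)[b neq_ij]; apply: signsum_additive.
  by move=> c d; rewrite !(pairingD phi_perfect) addrACA.
by exists b; rewrite addr_eq0_F2.
Qed.

End PerfectPairing.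

Lemma exp2_scale (m : nat) :
  (2 <= m)%N ->
  [/\ 2 ^ m = 4 * 2 ^ (m - 2), 2 ^ (m - 1) = 2 * 2 ^ (m - 2),
      [/\ 2 ^ (2 * m) = 8 * 2 ^ (2 * m - 3),
          2 ^ (2 * m - 1) = 4 * 2 ^ (2 * m - 3)
        & 2 ^ (2 * m - 2) = 2 * 2 ^ (2 * m - 3)]
    & 0 < 2 * 2 ^ (m - 2) <= 2 ^ (2 * m - 3)]%N.
Proof.
move=> le2m.
have scale j k n : (j + k = n)%N -> (2 ^ n = 2 ^ j * 2 ^ k)%N.
  by move=> <-; rewrite expnD.
split; [| |split|].
- by apply: (scale 2%N); lia.
- by apply: (scale 1%N); lia.
- by apply: (scale 3%N); lia.
- by apply: (scale 2%N); lia.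
- by apply: (scale 1%N); lia.
- by rewrite -(scale 1%N _ (m - 1)%N) ?leq_exp2l ?expn_gt0 //; lia.
Qed.

Section BentTranslates.
Variables (V : finZmodType) (I : finType) (m : nat) (phi : V -> I -> 'F_2).
Hypothesis phi_perfect : perfect_pairing phi.
Hypothesis card_I : #|I| = (2 ^ (2 * m))%N.

Definition bent_wrt (g : I -> 'F_2) : Prop :=
  forall b, `|signsum (g \+ phi b)| = 2 ^+ m.

Definition bent_dual (g : I -> 'F_2) (b : V) : 'F_2 :=
  (signsum (g \+ phi b) != 2 ^+ m)%:R.

Definition bent_translate (g : I -> 'F_2) (b : V) : I -> 'F_2 :=
  fun i => g i + phi b i + bent_dual g b.

Definition bent_block (g : I -> 'F_2) (b : V) : {set I} :=
  supp (bent_translate g b).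

Definition bent_blocks (g : I -> 'F_2) : {set {set I}} :=
  [set bent_block g b | b : V].

Lemma eq_bent_wrt (g h : I -> 'F_2) : g =1 h -> bent_wrt g -> bent_wrt h.
Proof.
move=> eq_gh g_bent b; rewrite -(g_bent b); congr `|_|.
by apply: eq_signsum => i; rewrite /= eq_gh.
Qed.

Lemma bent_wrt_affine (g : I -> 'F_2) b k :
  bent_wrt g -> bent_wrt (fun i => g i + phi b i + k).
Proof.
move=> g_bent c; rewrite -(g_bent (b + c)) -[RHS](normr_signsum_addc _ k).
congr `|_|; apply: eq_signsum => i; rewrite /= pairingD //=.
by rewrite addrAC -!addrA.
Qed.

Variable g : I -> 'F_2.
Hypothesis g_bent : bent_wrt g.

Lemma signsum_translate b : signsum (bent_translate g b) = 2 ^+ m.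
Proof.
rewrite signsum_addc /bent_dual; have /eqP := g_bent b.
rewrite eqr_norml => /andP[/pred2P[] -> _]; first by rewrite eqxx mulr1.
by case: eqP => [-> | _]; rewrite ?mulr1 // mulrN1 opprK.
Qed.

Lemma bent_dual_unique b c :
  signsum (fun i => g i + phi b i + c) = 2 ^+ m -> c = bent_dual g b.
Proof.
have neq0 : signsum (g \+ phi b) != 0 by rewrite -normr_eq0 g_bent expf_neq0.
rewrite -(signsum_translate b) !signsum_addc => /(mulfI neq0).
exact: sgn_inj.
Qed.

Lemma bent_translateD b c i :
  bent_translate g b i + bent_translate g c i
  = phi (b + c) i + (bent_dual g b + bent_dual g c).
Proof.
rewrite /bent_translate addrACA; congr (_ + _).
by rewrite addrACA addrr_F2 add0r pairingD.
Qed.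

Lemma signsum_translateD b c :
  b != c -> signsum (bent_translate g b \+ bent_translate g c) = 0.
Proof.
move=> neq_bc; have neq0 : b + c != 0.
  apply: contra neq_bc; rewrite addr_eq0 => /eqP->; rewrite eq_sym -addr_eq0.
  by rewrite (pairing_addrr phi_perfect) // card_I expn_gt0.
rewrite (eq_signsum (bent_translateD b c)) signsum_addc pairing_balanced //.
by rewrite mul0r.
Qed.

Lemma normr_signsum_translateDD b c d :
  `|signsum (bent_translate g b \+ bent_translate g c \+ bent_translate g d)|
  = 2 ^+ m.
Proof.
rewrite -(g_bent (b + c + d)).
rewrite -[RHS](normr_signsum_addc _
  (bent_dual g b + bent_dual g c + bent_dual g d)).
congr `|_|; apply: eq_signsum => i; rewrite /= bent_translateD.
rewrite (pairingD phi_perfect (b + c) d).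
rewrite /bent_translate addrACA /=; congr (_ + _); exact: addrCA.
Qed.

Hypothesis le2m : (2 <= m)%N.

Lemma card_bent_block b :
  #|bent_block g b| = (2 ^ (2 * m - 1) - 2 ^ (m - 1))%N.
Proof.
have := card_supp (bent_translate g b); rewrite signsum_translate -natrX card_I.
by have [-> -> [-> -> _] _] := exp2_scale le2m; rewrite natz /bent_block; lia.
Qed.

Lemma card_bent_blockI b c :
  b != c ->
  #|bent_block g b :&: bent_block g c| = (2 ^ (2 * m - 2) - 2 ^ (m - 1))%N.
Proof.
move=> neq_bc; have := card_suppI (bent_translate g b) (bent_translate g c).
rewrite !signsum_translate signsum_translateD // -natrX card_I.
by have [-> -> [-> _ ->] _] := exp2_scale le2m; rewrite natz /bent_block; lia.
Qed.

Lemma card_bent_blockII b c d :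
  b != c -> b != d -> c != d ->
  (#|bent_block g b :&: bent_block g c :&: bent_block g d|
     = 2 ^ (2 * m - 3) - 2 ^ (m - 1))%N \/
  (#|bent_block g b :&: bent_block g c :&: bent_block g d|
     = 2 ^ (2 * m - 3) - 2 ^ (m - 2))%N.
Proof.
move=> neq_bc neq_bd neq_cd; have := normr_signsum_translateDD b c d.
have := card_suppII (bent_translate g b) (bent_translate g c)
  (bent_translate g d).
rewrite !signsum_translate !signsum_translateD // -natrX card_I.
by have [-> -> [-> _ _] _] := exp2_scale le2m; rewrite natz /bent_block; lia.
Qed.

Lemma bent_block_inj : injective (bent_block g).
Proof.
move=> b c eq_bc; apply: contraTeq isT => /card_bent_blockI.
rewrite eq_bc setIid card_bent_block.
by have [_ -> [_ -> ->] scale_gt0] := exp2_scale le2m; lia.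
Qed.

Lemma card_bent_blocksI :
  {in bent_blocks g &, forall B C, B != C ->
    #|B :&: C| = 2 ^ (2 * m - 2) - 2 ^ (m - 1)}%N.
Proof.
move=> B C /imsetP[b _ ->] /imsetP[c _ ->].
by rewrite (inj_eq bent_block_inj); apply: card_bent_blockI.
Qed.

Lemma card_bent_blocksII :
  {in bent_blocks g & &, forall B C D, B != C -> B != D -> C != D ->
    #|B :&: C :&: D| = 2 ^ (2 * m - 3) - 2 ^ (m - 1) \/
    #|B :&: C :&: D| = 2 ^ (2 * m - 3) - 2 ^ (m - 2)}%N.
Proof.
move=> B C D /imsetP[b _ ->] /imsetP[c _ ->] /imsetP[d _ ->].
by rewrite !(inj_eq bent_block_inj); apply: card_bent_blockII.
Qed.

Lemma signsum_translate_colD i j :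
  i != j -> signsum (fun b => bent_translate g b i + bent_translate g b j) = 0.
Proof.
move=> neq_ij; rewrite (@eq_signsum _ _
  (fun b => phi b i + phi b j + (g i + g j))) => [|b].
  by rewrite signsum_addc signsum_pairing_col // mul0r.
rewrite /bent_translate addrACA addrr_F2 addr0 addrACA.
exact: addrC.
Qed.

Hypothesis card_V : #|V| = (2 ^ (2 * m))%N.

(* Fourier inversion: [signsum_translate] lets one replace
   [2 ^+ m * sgn (bent_translate g b i)] by a double character sum. *)
Lemma signsum_translate_col i :
  signsum (fun b => bent_translate g b i) = 2 ^+ m.
Proof.
apply: (@mulIf _ (2 ^+ m)); first by rewrite expf_neq0.
rewrite [LHS]mulr_suml.
transitivity
  (\sum_b \sum_j sgn (bent_translate g b i + bent_translate g b j)).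
  apply: eq_bigr => b _; rewrite -(signsum_translate b) mulr_sumr.
  by apply: eq_bigr => j _; rewrite sgnD.
rewrite exchange_big (bigD1 i) //= [X in _ + X]big1 => [|j neq_ji]; last first.
  by rewrite -/(signsum _) signsum_translate_colD // eq_sym.
under eq_bigr do rewrite addrr_F2.
by rewrite sumr_const card_V addr0 mul2n -addnn expnD natrM natrX.
Qed.

Lemma bent_blocks_design :
  design 2 (2 ^ (2 * m)) (2 ^ (2 * m - 1) - 2 ^ (m - 1))
    (2 ^ (2 * m - 2) - 2 ^ (m - 1)) [set: I] (bent_blocks g).
Proof.
split.
- by have [_ -> [-> -> _] scale_gt0] := exp2_scale le2m; lia.
- by rewrite cardsT.
- by move=> _ /imsetP[b _ ->]; rewrite subsetT card_bent_block.
move=> _ _ /eqP/cards2P[i [j [neq_ij ->]]].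
have -> : [set B in bent_blocks g | [set i; j] \subset B]
    = [set bent_block g b | b in supp (bent_translate g ^~ i)
                                 :&: supp (bent_translate g ^~ j)].
  apply/setP => B; rewrite inE; apply/andP/imsetP => [[/imsetP[b _ ->]]|[b]].
    by rewrite subUset !sub1set !inE; exists b; rewrite // !inE.
  by rewrite !inE => ij_b ->; rewrite imset_f // subUset !sub1set !inE.
rewrite (card_imset _ bent_block_inj).
have := card_suppI (bent_translate g ^~ i) (bent_translate g ^~ j).
rewrite !signsum_translate_col signsum_translate_colD // -natrX card_V.
by have [-> -> [-> _ ->] _] := exp2_scale le2m; rewrite natz; lia.
Qed.

Lemma bent_blocks_derived B :
  B \in bent_blocks g ->
  let Bde := derived_blocks (2 ^ (2 * m - 2) - 2 ^ (m - 1)) (bent_blocks g) B in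
  design 2 (2 ^ (2 * m - 1) - 2 ^ (m - 1)) (2 ^ (2 * m - 2) - 2 ^ (m - 1))
    (2 ^ (2 * m - 2) - 2 ^ (m - 1) - 1) B Bde
  /\ quasi_symmetric (2 ^ (2 * m - 3) - 2 ^ (m - 1))
       (2 ^ (2 * m - 3) - 2 ^ (m - 2)) Bde.
Proof.
move=> gB; have [_ def_m1 [_ def_2m1 def_2m2] scale_gt0] := exp2_scale le2m.
have lt_meet : (2 ^ (2 * m - 2) - 2 ^ (m - 1) < #|B|)%N.
  by have /imsetP[b _ ->] := gB; rewrite card_bent_block; lia.
have meet : {in bent_blocks g :\ B, forall C,
    #|B :&: C| = 2 ^ (2 * m - 2) - 2 ^ (m - 1)}%N.
  by move=> C /setD1P[neq_CB gC]; rewrite card_bent_blocksI // eq_sym.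
have triple : {in bent_blocks g :\ B &, forall C D, C != D ->
    #|B :&: C :&: D| = 2 ^ (2 * m - 3) - 2 ^ (m - 1) \/
    #|B :&: C :&: D| = 2 ^ (2 * m - 3) - 2 ^ (m - 2)}%N.
  move=> C D /setD1P[neq_CB gC] /setD1P[neq_DB gD] neq_CD.
  by apply: card_bent_blocksII; rewrite // eq_sym.
split; last by apply: derived_quasi_symmetric triple => //; lia.
apply: derived_design bent_blocks_design _ => //; first lia.
apply: setI_inj_of_triple_meets meet _ => C D BsC BsD neq_CD.
by have [->|->] := triple C D BsC BsD neq_CD; lia.
Qed.

End BentTranslates.

(** * Codes whose words are affine or bent *)

Lemma min_weight_codewordE (n w : nat) (C : {vspace 'rV['F_2]_n})
    (c0 : 'rV['F_2]_n) :
  c0 \in C -> c0 != 0 -> weight c0 = w ->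
  (forall c, c \in C -> c != 0 -> (w <= weight c)%N) ->
  forall c, min_weight_codeword C c = [&& c \in C, c != 0 & weight c == w].
Proof.
move=> Cc0 c0_neq0 wt_c0 min_w c; rewrite /min_weight_codeword.
case Cc: (c \in C) => //=; case: eqP => //= /eqP c_neq0.
apply/forallP/eqP => [min_c | -> c'].
  apply/eqP; rewrite eqn_leq min_w // andbT -wt_c0.
  by have /implyP := min_c c0; rewrite Cc0 c0_neq0; apply.
by apply/implyP => /andP[]; apply: min_w.
Qed.

Section WeightSignsum.
Variables n m : nat.
Hypotheses (def_n : n = (2 ^ (2 * m))%N) (le2m : (2 <= m)%N).

Let card_I : #|'I_n| = (2 ^ (2 * m))%N.
Proof. by rewrite card_ord. Qed.

Lemma weight_signsum (c : 'rV['F_2]_n) :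
  2 * (weight c)%:Z = (2 ^ (2 * m))%N%:Z - signsum (c 0).
Proof. by rewrite -card_I -card_supp. Qed.

Lemma weight_eq_signsum (c : 'rV['F_2]_n) :
  (weight c == 2 ^ (2 * m - 1) - 2 ^ (m - 1))%N = (signsum (c 0) == 2 ^+ m).
Proof.
have := weight_signsum c; rewrite -natrX natz.
have [-> -> [-> -> _] scale_gt0] := exp2_scale le2m.
by move: (signsum _) => x; lia.
Qed.

Lemma leq_weight_signsum (c : 'rV['F_2]_n) :
  (2 ^ (2 * m - 1) - 2 ^ (m - 1) <= weight c)%N = (signsum (c 0) <= 2 ^+ m).
Proof.
have := weight_signsum c; rewrite -natrX natz.
have [-> -> [-> -> _] scale_gt0] := exp2_scale le2m.
by move: (signsum _) => x; lia.
Qed.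

Lemma signsum_exp2_neq0 (c : 'rV['F_2]_n) : signsum (c 0) = 2 ^+ m -> c != 0.
Proof.
apply: contra_eq_neq => ->; rewrite (@eq_signsum _ _ (fun=> 0)) => [|i].
  rewrite signsum_const mulr1 card_I -natrX natz.
  by have [-> _ [-> _ _] scale_gt0] := exp2_scale le2m; lia.
by rewrite mxE.
Qed.

End WeightSignsum.

Section AffineOrBentCode.
Variables (V : finZmodType) (n m : nat) (phi : V -> 'I_n -> 'F_2).
Hypothesis phi_perfect : perfect_pairing phi.
Hypotheses (def_n : n = (2 ^ (2 * m))%N) (le2m : (2 <= m)%N).

Let card_I : #|'I_n| = (2 ^ (2 * m))%N.
Proof. by rewrite card_ord. Qed.

Definition affine_word (b : V) (k : 'F_2) : 'rV['F_2]_n :=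
  \row_i (phi b i + k).

Lemma signsum_affine_word b k :
  signsum (affine_word b k 0)
  = if b == 0 then (2 ^ (2 * m))%N%:Z * sgn k else 0.
Proof.
rewrite (@eq_signsum _ _ (fun i => phi b i + k)) => [|i]; last by rewrite mxE.
have [-> | b_neq0] := eqVneq b 0; last first.
  by rewrite signsum_addc pairing_balanced // mul0r.
rewrite -card_I -signsum_const; apply: eq_signsum => i.
by rewrite pairing0 // add0r.
Qed.

Lemma normr_signsum_bent_wrt h : bent_wrt m phi h -> `|signsum h| = 2 ^+ m.
Proof.
move=> /(_ 0) <-; congr `|_|; apply: eq_signsum => i.
by rewrite /= pairing0 // addr0.
Qed.

Variable C : {vspace 'rV['F_2]_n}.
Hypothesis C_affine : forall b k, affine_word b k \in C.
Hypothesis C_affine_or_bent : forall c, c \in C ->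
  (exists b k, c = affine_word b k) \/ bent_wrt m phi (c 0).

Lemma signsum_codeword_le c : c \in C -> c != 0 -> signsum (c 0) <= 2 ^+ m.
Proof.
move=> /C_affine_or_bent[[b [k ->]] | /normr_signsum_bent_wrt <-]; last first.
  by rewrite ler_norm.
move=> neq0; rewrite signsum_affine_word.
case: (b =P 0) neq0 => [-> | _ _]; last exact: exprn_ge0.
case: (F2P k) => [/eqP[]|_]; last by rewrite mulrN1 -natrX natz; lia.
by apply/rowP => i; rewrite !mxE pairing0 // addr0.
Qed.

Definition translate_word (c : 'rV['F_2]_n) (b : V) : 'rV['F_2]_n :=
  \row_i bent_translate m phi (c 0) b i.

Lemma translate_word_in_code c b : c \in C -> translate_word c b \in C.
Proof.
move=> Cc; suff -> : translate_word c b
    = c + affine_word b (bent_dual m phi (c 0) b) by rewrite memvD.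
by apply/rowP => i; rewrite !mxE addrA.
Qed.

Lemma signsum_translate_word (c : 'rV['F_2]_n) b :
  bent_wrt m phi (c 0) -> signsum (translate_word c b 0) = 2 ^+ m.
Proof.
by move=> /signsum_translate/(_ b) <-; apply: eq_signsum => i; rewrite mxE.
Qed.

Variable g : 'rV['F_2]_n.
Hypotheses (Cg : g \in C) (g_bent : bent_wrt m phi (g 0)).

Lemma min_weight_codeword_signsum c :
  min_weight_codeword C c = (c \in C) && (signsum (c 0) == 2 ^+ m).
Proof.
have sum_g : signsum (translate_word g 0 0) = 2 ^+ m.
  exact: signsum_translate_word.
rewrite (min_weight_codewordE (translate_word_in_code 0 Cg)
  (signsum_exp2_neq0 def_n le2m sum_g) (w := (2 ^ (2 * m - 1) - 2 ^ (m - 1))%N)).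
- rewrite weight_eq_signsum //; case: (c \in C) => //=.
  case: (_ =P 2 ^+ m) => [/signsum_exp2_neq0 -> // | _].
  by rewrite andbF.
- by apply/eqP; rewrite weight_eq_signsum ?sum_g.
- by move=> c' Cc' c'_neq0; rewrite leq_weight_signsum ?signsum_codeword_le.
Qed.

Lemma min_weight_codeword_bent c :
  min_weight_codeword C c -> bent_wrt m phi (c 0).
Proof.
rewrite min_weight_codeword_signsum.
case/andP => /C_affine_or_bent[[b [k ->]] | //].
rewrite signsum_affine_word -natrX natz.
have [-> _ [-> _ _] scale_gt0] := exp2_scale le2m.
by case: (b =P 0) => _ /eqP; case: (F2P k); rewrite ?mulr1 ?mulrN1; lia.
Qed.

Lemma bent_block_in_min_weight_blocks c b :
  min_weight_codeword C c -> bent_block m phi (c 0) b \in min_weight_blocks C.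
Proof.
move=> min_c; have c_bent := min_weight_codeword_bent min_c.
move: min_c; rewrite min_weight_codeword_signsum => /andP[Cc _].
apply/imsetP; exists (translate_word c b).
  rewrite inE min_weight_codeword_signsum translate_word_in_code //=.
  exact/eqP/signsum_translate_word.
by apply/setP => i; rewrite !inE mxE.
Qed.

Lemma support_add_affine_word c c' b k :
  min_weight_codeword C c -> min_weight_codeword C c' ->
  c' = c + affine_word b k -> Defs.support c' = bent_block m phi (c 0) b.
Proof.
move=> min_c; have c_bent := min_weight_codeword_bent min_c.
rewrite min_weight_codeword_signsum => /andP[_ /eqP sum_c'] def_c'.
have def_c'i i : c' 0 i = c 0 i + phi b i + k by rewrite def_c' !mxE addrA.
have def_k : k = bent_dual m phi (c 0) b.
  by apply: bent_dual_unique => //; rewrite -(eq_signsum def_c'i).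
by apply: eq_supp => i; rewrite def_c'i def_k.
Qed.

Lemma support_in_bent_blocks c :
  min_weight_codeword C c -> Defs.support c \in bent_blocks m phi (c 0).
Proof.
move=> min_c; apply/imsetP; exists 0 => //.
apply: (support_add_affine_word (k := 0)) => //.
by apply/rowP => i; rewrite !mxE pairing0 // !addr0.
Qed.

Lemma meeting_support_in_bent_blocks c c' :
  min_weight_codeword C c -> min_weight_codeword C c' ->
  #|Defs.support c :&: Defs.support c'| = (2 ^ (2 * m - 2) - 2 ^ (m - 1))%N ->
  Defs.support c' \in bent_blocks m phi (c 0).
Proof.
move=> min_c min_c' card_cc'.
have := min_c; rewrite min_weight_codeword_signsum => /andP[Cc /eqP sum_c].
have := min_c'; rewrite min_weight_codeword_signsum => /andP[Cc' /eqP sum_c'].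
have sum0 : signsum ((c' - c) 0) = 0.
  rewrite (@eq_signsum _ _ (c 0 \+ c' 0)) => [|i]; last first.
    by rewrite !mxE oppr_F2 addrC.
  have := card_suppI (c 0) (c' 0).
  rewrite card_cc' sum_c sum_c' card_I -natrX natz.
  have [-> -> [-> _ ->] scale_gt0] := exp2_scale le2m.
  move: (signsum _) => x; lia.
have := C_affine_or_bent (memvB Cc' Cc).
case=> [[b [k def_c']] | /normr_signsum_bent_wrt]; last first.
  by rewrite sum0 normr0 => /eqP; rewrite eq_sym expf_eq0 andbF.
apply/imsetP; exists b => //.
apply: (support_add_affine_word (k := k)) => //.
by rewrite -def_c' addrC subrK.
Qed.

Hypothesis card_V : #|V| = (2 ^ (2 * m))%N.

Lemma min_weight_blocks_derived B :
  B \in min_weight_blocks C ->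
  let Bde := derived_blocks (2 ^ (2 * m - 2) - 2 ^ (m - 1))
               (min_weight_blocks C) B in
  design 2 (2 ^ (2 * m - 1) - 2 ^ (m - 1)) (2 ^ (2 * m - 2) - 2 ^ (m - 1))
    (2 ^ (2 * m - 2) - 2 ^ (m - 1) - 1) B Bde
  /\ quasi_symmetric (2 ^ (2 * m - 3) - 2 ^ (m - 1))
       (2 ^ (2 * m - 3) - 2 ^ (m - 2)) Bde.
Proof.
move=> /imsetP[c + ->]; rewrite inE => min_c.
rewrite (@eq_derived_blocks _ _ _ _ (bent_blocks m phi (c 0))) => [|B' meet_B'].
  apply: bent_blocks_derived => //.
  - exact: min_weight_codeword_bent.
  - exact: support_in_bent_blocks.
apply/idP/idP => [|/imsetP[b _ ->]]; last first.
  exact: bent_block_in_min_weight_blocks.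
case/imsetP=> c' + def_B'; rewrite inE def_B' in meet_B' * => min_c'.
exact: meeting_support_in_bent_blocks.
Qed.

End AffineOrBentCode.

(** * The trace pairing *)

Section Trace.
Variables (K : finFieldType) (m : nat).
Hypothesis card_K : #|K| = (2 ^ (2 * m))%N.

Lemma trace_inD : {morph @trace_in K m : x y / x + y}.
Proof.
move=> x y; rewrite -big_split /=; apply: eq_bigr => i _.
by rewrite exprDn_pchar // pnatX pnatE // (card_finPcharP card_K).
Qed.

Lemma trD : {morph @tr K m : x y / x + y}.
Proof.
move=> x y; rewrite {1}/tr trace_inD -!(trE card_K).
have pchar2 : 2 \in [pchar K] by apply: (card_finPcharP card_K).
case: (F2P (tr m x)); case: (F2P (tr m y));
  rewrite -?[nat_of_ord 0]/0%N -?[nat_of_ord 1]/1%N;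
  by rewrite ?addr0 ?add0r ?addrr_F2 ?(addrr_pchar2 pchar2) ?oner_eq0 ?eqxx.
Qed.

Definition trace_poly : {poly K} := \sum_(i < 2 * m) 'X^(2 ^ i).

Lemma horner_trace_poly x : trace_poly.[x] = trace_in m x.
Proof. by rewrite horner_sum; apply: eq_bigr => i _; rewrite hornerXn. Qed.

Lemma trace_poly_neq0 : trace_poly != 0.
Proof.
have : trace_poly`_1 != 0; last by apply: contraNneq => ->; rewrite coef0.
rewrite /trace_poly coef_sum; case: (2 * m)%N card_K => [card_K1 | n _].
  by have := finNzRing_gt1 K; rewrite card_K1.
rewrite big_ord_recl /= coefXn eqxx big1 ?addr0 ?oner_neq0 // => i _.
by rewrite coefXn /= expnS; case: eqP => //; lia.
Qed.

Lemma size_trace_poly : (size trace_poly <= #|K|)%N.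
Proof.
apply: leq_trans (size_sum _ _ _) _; apply/bigmax_leqP => i _.
by rewrite size_polyXn card_K ltn_exp2l.
Qed.

Lemma exists_tr_neq0 : exists x : K, tr m x != 0.
Proof.
apply/existsP; apply: contraT => /existsPn tr_eq0.
have roots : all (root trace_poly) (enum K).
  apply/allP => x _; rewrite /root horner_trace_poly -(trE card_K).
  by have := tr_eq0 x; rewrite negbK => /eqP->.
have := max_poly_roots trace_poly_neq0 roots (enum_uniq K).
by rewrite -cardE ltnNge size_trace_poly.
Qed.

Variables (I : finType) (u : I -> K).
Hypothesis u_bij : bijective u.

Definition trace_pairing (b : K) (i : I) : 'F_2 := tr m (b * u i).

Lemma trace_pairing_perfect : perfect_pairing trace_pairing.
Proof.
have [x0 tr_x0] := exists_tr_neq0.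
have tr_mul_neq0 (b : K) : b != 0 -> exists x, tr m (b * x) != 0.
  by move=> b_neq0; exists (x0 / b); rewrite mulrCA divff ?mulr1.
split=> [b c i | b b_neq0 | i j neq_ij].
- by rewrite /trace_pairing mulrDl trD.
- rewrite (signsum_comp (fun x => tr m (b * x)) u_bij) signsum_additive //.
    by move=> x y; rewrite mulrDr trD.
  exact: tr_mul_neq0.
have [|b tr_b] := @tr_mul_neq0 (u i - u j); first by rewrite subr_eq0 bij_eq.
exists b; apply: contraNneq tr_b => eq_ij.
have := trD ((u i - u j) * b) (u j * b).
rewrite -mulrDl subrK !(mulrC (u _)) [tr _ (b * u i)]eq_ij -[LHS]add0r.
by move=> /addIr <-.
Qed.

Lemma bent_wrt_comp (h : K -> 'F_2) :
  bent m h -> bent_wrt m trace_pairing (h \o u).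
Proof.
move=> h_bent b; rewrite -(h_bent b); congr `|_|.
exact: (signsum_comp (fun x => h x + tr m (b * x))).
Qed.

End Trace.

(** * The code of a bent vectorial function *)

Lemma span_F2_closed (V : vectType 'F_2) (s : seq V) :
  0 \in s -> {in s &, forall x y, x + y \in s} -> {subset <<s>>%VS <= s}.
Proof.
move=> s0 sD x /(coord_span (X := in_tuple s)) ->.
apply: (big_ind (fun y => y \in s)) => // i _.
by case: (F2P (coord _ _ _)); rewrite ?scale0r ?scale1r ?mem_nth.
Qed.

Lemma mem_span_image (F : fieldType) (V : vectType F) (I : finType) (t : I -> V)
    (x : V) :
  x \in <<[seq t i | i <- enum I]>>%VS ->
  exists a : I -> F, x = \sum_i a i *: t i.
Proof.
rewrite span_def big_map big_enum => /memv_sumP[y line_y ->].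
have /fin_all_exists[a def_y] i : exists k, y i = k *: t i.
  exact/vlineP/line_y.
by exists a; apply: eq_bigr => i _; rewrite def_y.
Qed.

Section BentCode.
Variables (K : finFieldType) (m n l : nat).
Variables (u : 'I_n -> K) (f : 'I_l -> K -> 'F_2).
Hypotheses (card_K : #|K| = (2 ^ (2 * m))%N) (u_bij : bijective u).
Hypothesis f_bent : bent_vectorial m f.

Let phi := trace_pairing m u.
Let phi_perfect : perfect_pairing phi := trace_pairing_perfect card_K u_bij.

Lemma mem_RM1 c : reflect (exists b k, c = affine_word phi b k) (c \in RM1 m u).
Proof.
apply: (iffP allpairsP) => [[[b k] [_ _ ->]] | [b [k ->]]].
  by exists b, k.
by exists (b, k); rewrite !mem_enum.
Qed.

Lemma affine_word_in_bent_code b k : affine_word phi b k \in bent_code m u f.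
Proof.
apply: memv_span; rewrite mem_cat; apply/orP; left.
by apply/mem_RM1; exists b, k.
Qed.

Lemma span_RM1 : {subset <<RM1 m u>>%VS <= RM1 m u}.
Proof.
apply: span_F2_closed => [|_ _ /mem_RM1[b [k ->]] /mem_RM1[b' [k' ->]]].
  by apply/mem_RM1; exists 0, 0; apply/rowP => i; rewrite !mxE pairing0 ?addr0.
apply/mem_RM1; exists (b + b'), (k + k').
by apply/rowP => i; rewrite !mxE pairingD //= addrACA.
Qed.

Lemma bent_component j : bent m (f j).
Proof.
have delta_neq0 : delta_mx 0 j != 0 :> 'rV['F_2]_l.
  by apply/eqP => /rowP/(_ j); rewrite !mxE !eqxx.
move=> w; rewrite -(f_bent delta_neq0 w); congr `|_|; apply: eq_bigr => x _.
congr ((-1) ^+ nat_of_ord (_ + _)); rewrite (bigD1 j) //= big1 => [|j' neq_j'].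
  by rewrite mxE !eqxx mul1r addr0.
by rewrite mxE (negPf neq_j') andbF mul0r.
Qed.

Lemma truth_table_in_bent_code j : truth_table u (f j) \in bent_code m u f.
Proof. by rewrite memv_span // mem_cat map_f ?orbT ?mem_enum. Qed.

Lemma bent_wrt_truth_table j : bent_wrt m phi (truth_table u (f j) 0).
Proof.
apply: eq_bent_wrt (bent_wrt_comp u_bij (bent_component j)) => i.
by rewrite mxE.
Qed.

Lemma bent_code_affine_or_bent c :
  c \in bent_code m u f ->
  (exists b k, c = affine_word phi b k) \/ bent_wrt m phi (c 0).
Proof.
rewrite /bent_code span_cat => /memv_addP[v /span_RM1/mem_RM1[b [k ->]]].
move=> [w /mem_span_image[a def_w] def_c]; pose r := \row_j a j.
have [r0 | r_neq0] := eqVneq r 0.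
  left; exists b, k; rewrite def_c def_w big1 ?addr0 // => j _.
  by have /rowP/(_ j) := r0; rewrite !mxE => ->; rewrite scale0r.
right; have r_bent := bent_wrt_comp u_bij (f_bent r_neq0).
apply: eq_bent_wrt (bent_wrt_affine phi_perfect b k r_bent) => i.
rewrite def_c def_w !mxE summxE addrC addrA; do 2 congr (_ + _).
by apply: eq_bigr => j _; rewrite !mxE.
Qed.

End BentCode.

Local Close Scope ring_scope.

Theorem theorem25 (m l : nat) (K : finFieldType)
    (u : 'I_(2 ^ (2 * m)) -> K) (f : 'I_l -> K -> 'F_2) :
  2 <= m ->
  1 <= l <= m ->
  #|K| = 2 ^ (2 * m) ->
  bijective u ->
  bent_vectorial m f ->
  forall B : {set 'I_(2 ^ (2 * m))},
    B \in min_weight_blocks (bent_code m u f) ->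
    let Bde := derived_blocks (2 ^ (2 * m - 2) - 2 ^ (m - 1))
                 (min_weight_blocks (bent_code m u f)) B in
    design 2 (2 ^ (2 * m - 1) - 2 ^ (m - 1))
             (2 ^ (2 * m - 2) - 2 ^ (m - 1))
             (2 ^ (2 * m - 2) - 2 ^ (m - 1) - 1) B Bde
    /\ quasi_symmetric (2 ^ (2 * m - 3) - 2 ^ (m - 1))
                       (2 ^ (2 * m - 3) - 2 ^ (m - 2)) Bde.
Proof.
move=> le2m /andP[l_gt0 _] card_K u_bij f_bent B.
pose j0 := Ordinal l_gt0; have f0_bent := bent_wrt_truth_table u_bij f_bent j0.
have phi_perfect := trace_pairing_perfect card_K u_bij.
have affine_in_code := affine_word_in_bent_code m u f.
have affine_or_bent := bent_code_affine_or_bent card_K u_bij f_bent.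
have f0_in_code := truth_table_in_bent_code m u f j0.
exact: (min_weight_blocks_derived phi_perfect erefl le2m affine_in_code
  affine_or_bent f0_in_code f0_bent card_K).
Qed.
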